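(* Let $n\in\{2,3\}$, and let $S=S_n$ or $S=S'_n$. Let $v=\{[f_1,D_1],\dots,[f_m,D_m]\}$ be a vertex in $\Delta(S)$ (with $m$ elements), and let $\Gamma=V(S)$. The stabilizer group $\Gamma_v$ is virtually free abelian of rank at most $m$.
   Context: Let $I=[0,1)$; $A:I\to[0,1/2)$, $A(x)=\frac{x}{x+1}$; $B:I\to[1/2,1)$, $B(x)=\frac1{2-x}$; $C_n:I\to I$, $C_n(x)=\frac{nx}{(n-1)x+1}$ ($n=2,3$); $T:[0,\infty)\to[1,\infty)$, $T(x)=x+1$. Partial bijections are composed wherever the composition makes sense. $S_n=\langle A,B,C_n\rangle$ and $S'_n=\langle A,B,C_n,T\rangle$ are the generated inverse semigroups of partial bijections (closed under compositions and inverses). Put $X=[0,1)$ if $S=S_n$ and $X=[0,\infty)$ if $S=S'_n$. $\mathcal{D}_S^+$ is the set of non-empty domains of elements of $S$; $\widehat S$ is the set of all bijections $f:P\to Q$ between subsets of $X$ for which there is a finite partition of $P$ into members $D$ of $\mathcal{D}_S^+$ with each $f|_D\in S$. $V(S)$ is the group of right-continuous bijections of $X$ belonging to $\widehat S$. $\mathcal{D}^+_{gen}=\{\omega I\mid\omega\in\{A,B\}^*\}$ if $S=S_n$, and $\mathcal{D}^+_{gen}=\{T^\alpha\omega I\mid\omega\in\{A,B\}^*,\alpha\ge0\}\cup\{[\alpha,\infty)\mid\alpha\in\mathbb{Z}_{\ge0}\}$ if $S=S'_n$. For $D_1,D_2\in\mathcal{D}^+_{gen}$, $\mathbb{S}(D_1,D_2)$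 is the set of $s\in S$ with domain $D_1$ and image $D_2$. On pairs $(f,D)$ with $f\in\widehat S$, $D\in\mathcal{D}^+_{gen}$, $D\subseteq\mathrm{dom}(f)$, put $(f_1,D_1)\sim(f_2,D_2)$ if there is $h\in\mathbb{S}(D_1,D_2)$ with $f_1|_{D_1}=f_2\circ h$. The class is $[f,D]$. A vertex is a finite set $\{[f_1,D_1],\dots,[f_m,D_m]\}$ of classes such that the sets $f_j(D_j)$ are pairwise disjoint with union $X$. The group $\Gamma=V(S)$ acts on vertices by $\gamma\cdot\{[f_1,D_1],\dots,[f_m,D_m]\}=\{[\gamma f_1,D_1],\dots,[\gamma f_m,D_m]\}$, and $\Gamma_v=\{\gamma\in\Gamma\mid\gamma\cdot v=v\}$. ($\Delta(S)$ is a simplicial complex whose vertex set is the set of all such vertices.) ''Virtually free abelian of rank at most $m$'' means having a finite-index subgroup isomorphic to $\mathbb{Z}^r$ for some $0\le r\le m$. *)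

(* Defs.v *)
From HB Require Import structures.
From mathcomp Require Import all_boot all_order all_algebra.
From mathcomp Require Import all_classical all_reals all_analysis.

Set Implicit Arguments.
Unset Strict Implicit.
Unset Printing Implicit Defensive.

Import Order.TTheory GRing.Theory Num.Theory.
Import numFieldNormedType.Exports.

Local Open Scope classical_set_scope.
Local Open Scope ring_scope.

Section VirtuallyFreeAbelian.
Context {G : groupType}.

Definition subgroup (K : set G) : Prop := group_closed (mem K).

Definition left_cosets (K H : set G) : set (set G) :=
  [set [set (g * h)%g | h in H] | g in K].

Definition free_abelian_of_rank (r : nat) (H : set G) : Prop :=
  exists2 phi : 'rV[int]_r -> G,
    set_bij setT H phi & {morph phi : a b / a + b >-> (a * b)%g}.

Definition virtually_free_abelian_of_rank_le (m : nat) (K : set G) : Prop :=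
  subgroup K /\
  exists (r : nat) (H : set G),
    [/\ (r <= m)%N, subgroup H, H `<=` K,
        finite_set (left_cosets K H) & free_abelian_of_rank r H].

End VirtuallyFreeAbelian.

(* Partial maps of the line are represented by their graphs, so that two of
   them are equal iff they have the same domain and the same values. *)
Definition parmap (R : realType) : Type := set (R * R).

Section PartialMaps.
Context {R : realType}.
Implicit Types (f g : parmap R) (D P Q : set R).

Definition parmap_of P (F : R -> R) : parmap R := [set (x, F x) | x in P].
Definition pdom f : set R := [set x | exists y, f (x, y)].
Definition pcomp g f : parmap R := [set p | exists2 y, f (p.1, y) & g (y, p.2)].
Definition pinv f : parmap R := [set p | f (p.2, p.1)].
Definition pimage f D : set R := [set y | exists2 x, D x & f (x, y)].
Definition prestrict f D : parmap R := [set p | f p /\ D p.1].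

Definition bijection P Q f : Prop :=
  [/\ pdom f = P, pimage f P = Q,
      forall x y y', f (x, y) -> f (x, y') -> y = y' &
      forall x x' y, f (x, y) -> f (x', y) -> x = x'].

(* The value outside [pdom f] is the junk value 0. *)
Definition papply f (x : R) : R := xget 0 [set y | f (x, y)].

Definition right_continuous_on P f : Prop :=
  forall x, P x -> papply f y @[y --> x^'+] --> papply f x.

Definition inverse_semigroup_closed (M : set (parmap R)) : Prop :=
  (forall f g, M f -> M g -> M (pcomp g f)) /\ (forall f, M f -> M (pinv f)).

Definition generated_inverse_semigroup (E : set (parmap R)) : set (parmap R) :=
  smallest inverse_semigroup_closed E.

Lemma pcompA f g (h : parmap R) : pcomp h (pcomp g f) = pcomp (pcomp h g) f.
Proof.
apply/seteqP; split=> -[x t] /=.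
  by move=> [z [y fxy gyz] hzt]; exists y => //; exists z.
by move=> [y fxy [z gyz hzt]]; exists z => //; exists y.
Qed.

Lemma bijection_pcomp P f g :
  bijection P P f -> bijection P P g -> bijection P P (pcomp g f).
Proof.
move=> [df If ff fi] [dg Ig gf gi]; split.
- apply/seteqP; split=> x /=.
    by move=> [z [y /= fxy _]]; rewrite -df; exists y.
  move=> Px; have [y fxy] : pdom f x by rewrite df.
  have : P y by rewrite -If; exists x.
  by rewrite -dg => -[z gyz]; exists z, y.
- apply/seteqP; split=> z /=.
    move=> [x Px [y /= fxy gyz]]; rewrite -Ig; exists y => //.
    by rewrite -If; exists x.
  by rewrite -{1}Ig => -[y]; rewrite -{1}If => -[x Px fxy] gyz; exists x => //; exists y.
- by move=> x z z' [y /= a b] [y' /= /(ff _ _ _ a) <-]; exact: gf.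
- by move=> x x' z [y /= a b] [y' /= a' /(gi _ _ _ b) e]; move: a'; rewrite -e; exact: fi.
Qed.

Lemma bijection_pinv P f : bijection P P f -> bijection P P (pinv f).
Proof.
move=> [df If ff fi]; split.
- apply/seteqP; split=> y /=.
    by move=> [x /= fxy]; rewrite -If; exists x => //; rewrite -df; exists y.
  by rewrite -{1}If => -[x _ fxy]; exists x.
- apply/seteqP; split=> x /=; first by move=> [y _ /= fxy]; rewrite -df; exists y.
  rewrite -{1}df => -[y fxy]; exists y => //.
  by rewrite -If; exists x => //; rewrite -df; exists y.
- by move=> x y y' /= ? ?; apply: fi; eassumption.
- by move=> x y y' /= ? ?; apply: ff; eassumption.
Qed.

Lemma bijection_pid P : bijection P P (parmap_of P id).
Proof.
split.
- by apply/seteqP; split=> x /= => [[y [z Pz [<- _]]]//|Px]; exists x, x.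
- apply/seteqP; split=> x /= => [[y _ [z Pz [_ <-]]]//|Px].
  by exists x => //; exists x.
- by move=> x y y' [z _ [<- <-]] [? _ [<- <-]].
- by move=> x y y' [z _ [<- <-]] [? _ [<- <-]].
Qed.

End PartialMaps.

Section SymmetricGroup.
Context {R : realType} (X : set R).

Record sym : Type := Sym {
  graph :> parmap R;
  graph_bij : bijection X X graph
}.

HB.instance Definition _ := gen_eqMixin sym.
HB.instance Definition _ := gen_choiceMixin sym.

Lemma sym_eq (f g : sym) : graph f = graph g -> f = g.
Proof.
case: f g => f fP [g gP] /= e; case: _ / e gP => gP.
by congr Sym; exact: Prop_irrelevance.
Qed.

Definition sym_one : sym := Sym (bijection_pid X).
Definition sym_mul (g f : sym) : sym :=
  Sym (bijection_pcomp (graph_bij f) (graph_bij g)).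
Definition sym_inv (f : sym) : sym := Sym (bijection_pinv (graph_bij f)).

Let sym_mulA : associative sym_mul.
Proof. by move=> f g h; apply: sym_eq => /=; rewrite pcompA. Qed.

Let sym_mul1 : left_id sym_one sym_mul.
Proof.
move=> f; apply: sym_eq; case: f => f [df If ff fi] /=.
apply/seteqP; split=> -[x y] /=; first by move=> [z fxz [t _ [tz <-]]]; rewrite tz.
move=> fxy; exists y => //; exists y => //.
by rewrite -If; exists x => //; rewrite -df; exists y.
Qed.

Let sym_mulr1 : right_id sym_one sym_mul.
Proof.
move=> f; apply: sym_eq; case: f => f [df If ff fi] /=.
apply/seteqP; split=> -[x y] /=; first by move=> [z [t _ [<- <-]]].
by move=> fxy; exists x => //; exists x => //; rewrite -df; exists y.
Qed.

Let sym_mulV : left_inverse sym_one sym_inv sym_mul.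
Proof.
move=> f; apply: sym_eq; case: f => f [df If ff fi] /=.
apply/seteqP; split=> -[x y] /=.
  move=> [z /= fxz fyz]; exists x; first by rewrite -df; exists z.
  by have <- : x = y by exact: (fi x y z).
by move=> [t]; rewrite -{1}df => -[z ftz] [<- <-]; exists z.
Qed.

Let sym_mulrV : right_inverse sym_one sym_inv sym_mul.
Proof.
move=> f; apply: sym_eq; case: f => f [df If ff fi] /=.
apply/seteqP; split=> -[x y] /=.
  move=> [z /= fzx fzy]; have <- : x = y by exact: (ff z x y).
  exists x => //.
  by rewrite -If; exists z => //; rewrite -df; exists x.
by move=> [t]; rewrite -{1}If => -[z _ fzt] [<- <-]; exists z.
Qed.

HB.instance Definition _ :=
  isGroup.Build sym sym_mulA sym_mul1 sym_mulr1 sym_mulV sym_mulrV.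

End SymmetricGroup.

Section Complex.
Context {R : realType}.

Definition I01 : set R := `[0, 1[.
Definition halfline (a : R) : set R := `[a, +oo[.
Definition mapA : parmap R := parmap_of I01 (fun x => x / (x + 1)).
Definition mapB : parmap R := parmap_of I01 (fun x => 1 / (2 - x)).
Definition mapC (n : nat) : parmap R :=
  parmap_of I01 (fun x => n%:R * x / ((n%:R - 1) * x + 1)).
Definition mapT : parmap R := parmap_of (halfline 0) (fun x => x + 1).

(* Throughout, [primed = false] is the case S = S_n, X = [0, 1) and
   [primed = true] is the case S = S'_n, X = [0, +oo). *)
Context (n : nat) (primed : bool).

Definition Xspace : set R := if primed then halfline 0 else I01.

Definition generators : set (parmap R) :=
  [set mapA; mapB; mapC n] `|` (if primed then [set mapT] else set0).

Definition semigrp : set (parmap R) := generated_inverse_semigroup generators.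

Definition Dplus : set (set R) :=
  [set D | D !=set0 /\ exists2 s, semigrp s & D = pdom s].

Definition Shat : set (parmap R) :=
  [set f | exists P Q : set R,
    [/\ P `<=` Xspace, Q `<=` Xspace, bijection P Q f &
        exists Ds : set (set R),
          [/\ finite_set Ds, Ds `<=` Dplus, partition Ds id P &
              forall D, Ds D -> semigrp (prestrict f D)]]].

Definition Vgroup : set (sym Xspace) :=
  [set gamma | Shat gamma /\ right_continuous_on Xspace gamma].

(* [word_image w] is omega I, where the word omega has letter A at the
   positions where [w] is true and letter B at the others. *)
Definition word_image (w : seq bool) : set R :=
  foldr (fun b D => pimage (if b then mapA else mapB) D) I01 w.

Definition Dgen : set (set R) :=
  if primed then
    [set D | exists (alpha : nat) (w : seq bool),
               D = iter alpha (pimage mapT) (word_image w)] `|`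
    [set D | exists alpha : nat, D = halfline alpha%:R]
  else [set D | exists w : seq bool, D = word_image w].

Definition SSet (D1 D2 : set R) : set (parmap R) :=
  [set s | [/\ semigrp s, pdom s = D1 & pimage s D1 = D2]].

Definition marked : set (parmap R * set R) :=
  [set p | [/\ Shat p.1, Dgen p.2 & p.2 `<=` pdom p.1]].

Definition sim (p q : parmap R * set R) : Prop :=
  exists2 h, SSet p.2 q.2 h & prestrict p.1 p.2 = pcomp q.1 h.

Definition cls (p : parmap R * set R) : set (parmap R * set R) :=
  [set q | marked q /\ sim p q].

Definition is_vertex (v : set (set (parmap R * set R))) : Prop :=
  exists (k : nat) (f : 'I_k -> parmap R) (D : 'I_k -> set R),
    [/\ forall j, marked (f j, D j),
        v = [set cls (f j, D j) | j in [set: 'I_k]],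
        trivIset [set: 'I_k] (fun j => pimage (f j) (D j)) &
        \bigcup_j pimage (f j) (D j) = Xspace].

Definition act (gamma : sym Xspace) (v : set (set (parmap R * set R))) :
    set (set (parmap R * set R)) :=
  [set cls (pcomp gamma p.1, p.2) | p in [set p | marked p /\ v (cls p)]].

Definition stabilizer (v : set (set (parmap R * set R))) : set (sym Xspace) :=
  [set gamma | Vgroup gamma /\ act gamma v = v].

End Complex.

Arguments semigrp {R} n primed.
Arguments Dplus {R} n primed.
Arguments Shat {R} n primed.
Arguments Vgroup {R} n primed.
Arguments Dgen {R} primed.
Arguments SSet {R} n primed D1 D2.
Arguments marked {R} n primed.
Arguments sim {R} n primed p q.
Arguments cls {R} n primed p.
Arguments is_vertex {R} n primed v.
Arguments act {R} n primed gamma v.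
Arguments stabilizer {R} n primed v.

(* Main.v *)
(** Every element of the semigroup is the restriction of a Moebius map given by
    an integer matrix of determinant a power of [n], to a domain that is open to
    the right.  Every [D] in [Dgen] is the image of [0, +oo) under such a map,
    and such a self-bijection of [0, +oo) fixes 0 and +oo, so it is
    [x |-> (a / d) x] with [a d] a power of the prime [n], hence
    [x |-> n ^ z * x] with [z] an integer.  A vertex therefore splits [X] into
    [m] charts modelled on [0, +oo), and an element of the stabilizer permutes
    the charts, acting between them by multiplication by powers of [n].  The
    elements that preserve each chart form a subgroup of finite index, which
    the exponents embed into the lattice of integer vectors of length [m]. *)

From mathcomp Require Import all_boot all_order all_algebra.
From mathcomp Require Import all_classical all_reals all_analysis.
From mathcomp Require Import ring lra zify.
(* After the libraries, so that [pcomp] is the one of [Defs], not of [ssrfun]. *)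
Require Import Defs.

Set Implicit Arguments.
Unset Strict Implicit.
Unset Printing Implicit Defensive.

Import Order.TTheory GRing.Theory Num.Theory.
Import numFieldNormedType.Exports.

Local Open Scope classical_set_scope.
Local Open Scope card_scope.
Local Open Scope ring_scope.

(** * Subgroups of integer lattices *)

Lemma zmod_subgroupD (V : zmodType) (L : set V) :
  L 0 -> (forall a b, L a -> L b -> L (a - b)) ->
  forall a b, L a -> L b -> L (a + b).
Proof.
move=> L0 LB a b La Lb; rewrite -(opprK b) -[- b]sub0r; apply: (LB) => //.
exact: LB.
Qed.

Lemma zmod_subgroupMz (V : zmodType) (L : set V) :
  L 0 -> (forall a b, L a -> L b -> L (a - b)) ->
  forall a z, L a -> L (a *~ z).
Proof.
move=> L0 LB a z La; have LnM (k : nat) : L (a *+ k).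
  by elim: k => [|k IH]//; rewrite mulrS; exact: zmod_subgroupD.
case: z => k; first exact: LnM.
by rewrite NegzE mulrNz -sub0r; apply: LB => //; exact: LnM.
Qed.

(** The generator is the least positive element of [L], or 0 if [L] is trivial: the remainder of any
    element modulo it lies in [L], hence vanishes by minimality. *)
Lemma subgroup_int (L : set int) :
  L 0 -> (forall a b, L a -> L b -> L (a - b)) ->
  exists d : int, forall a, L a <-> exists z, a = z * d.
Proof.
move=> L0 LB.
have LM z a : L a -> L (z * a).
  by move=> La; rewrite mulrC -mulrzz; exact: zmod_subgroupMz.
have [[a0 La0 a0n]|L00] := pselect (exists2 a, L a & a != 0); last first.
  exists 0 => a; split=> [La|[z ->]]; last by rewrite mulr0.
  by exists 0; rewrite mulr0; apply: contrapT => /eqP an; apply: L00; exists a.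
have ex : exists k : nat, `[< (0 < k)%N /\ L k%:Z >].
  exists `|a0|%N; apply/asboolP; split; first by rewrite absz_gt0.
  by case: (ger0P a0) => h; [rewrite gez0_abs|rewrite ltz0_abs// -sub0r; exact: LB].
case: (ex_minnP ex) => d /asboolP[d0 Ld] dmin.
exists d%:Z => a; split=> [La|[z ->]]; last exact: LM.
exists (a %/ d)%Z; suff r0 : (a %% d)%Z = 0 by rewrite {1}(divz_eq a d) r0 addr0.
have Lr : L (a %% d)%Z.
  have -> : (a %% d)%Z = a - (a %/ d)%Z * d by rewrite {2}(divz_eq a d) addrC addKr.
  by apply: LB => //; exact: LM.
have r_ge0 : 0 <= (a %% d)%Z by apply: modz_ge0; lia.
have r_lt : (a %% d)%Z < d%:Z by apply: ltz_pmod; lia.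
apply/eqP; apply: contrapT => /negP rn.
have := dmin `|(a %% d)%Z|%N; rewrite leqNgt => /(_ _)/negP; apply; last lia.
by apply/asboolP; rewrite gez0_abs//; split=> //; lia.
Qed.

(** Induction on [k] through the first coordinate. The vectors of [L] whose first coordinate is 0
    form a subgroup of a smaller lattice, and the first coordinates of [L] form some d Z. The rows
    of [B] are a basis of [L]. *)
Lemma subgroup_lattice_free (k : nat) (L : set 'rV[int]_k) :
  L 0 -> (forall a b, L a -> L b -> L (a - b)) ->
  exists (r : nat) (B : 'M[int]_(r, k)),
    [/\ (r <= k)%N, injective (fun a : 'rV_r => a *m B) &
        forall u, L u <-> exists a, u = a *m B].
Proof.
elim: k L => [|k IH] L L0 LB.
  exists 0%N, 0; split=> // [a b _|u]; first by rewrite [a]thinmx0 [b]thinmx0.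
  by rewrite [u]thinmx0; split=> // _; exists 0; rewrite mul0mx.
rewrite -[k.+1]/(1 + k)%N in L L0 LB *.
have [||r [B [rk Binj BL]]] := IH [set u | L (row_mx 0 u)].
- by rewrite /= row_mx0.
- move=> a b /= La Lb; rewrite -[X in row_mx X _](subr0 0).
  by rewrite -add_row_mx -opp_row_mx; exact: LB.
have [||d dL] := @subgroup_int [set lsubmx u 0 0 | u in L].
- by exists 0 => //; rewrite linear0 mxE.
- move=> _ _ [u Lu <-] [w Lw <-]; exists (u - w); first exact: LB.
  by rewrite linearB /= !mxE.
have [g Lg gd] : [set lsubmx u 0 0 | u in L] d by apply/dL; exists 1; rewrite mul1r.
have gE : g = row_mx (d%:M) (rsubmx g).
  by rewrite -{1}(hsubmxK g); congr row_mx; rewrite [LHS]mx11_scalar gd.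
have LZ z u : L u -> L (z *: u).
  by move=> Lu; rewrite -[z]intz scaler_int; exact: zmod_subgroupMz.
have LD := zmod_subgroupD L0 LB.
(* If [d] is 0, all of [L] has first coordinate 0 and the basis given by induction is enough. *)
have [d0|dn0] := eqVneq d 0.
  exists r, (row_mx 0 B); split; first exact: (leq_trans rk).
    by move=> a b; rewrite !mul_mx_row !mulmx0 => /eq_row_mx[_ /Binj].
  move=> u; split=> [Lu|[a ->]]; last first.
    by rewrite mul_mx_row mulmx0; apply/BL; exists a.
  have u0 : lsubmx u = 0.
    have : [set lsubmx u 0 0 | u in L] (lsubmx u 0 0) by exists u.
    by move=> /dL[z]; rewrite d0 mulr0 => e; rewrite [LHS]mx11_scalar e raddf0.
  have /BL[a au] : L (row_mx 0 (rsubmx u)) by rewrite -u0 hsubmxK.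
  by exists a; rewrite mul_mx_row mulmx0 -au -u0 hsubmxK.
(* The new basis vector [g] is a lift of [d]; subtracting the right multiple of it from a vector of
   [L] kills the first coordinate. *)
exists (1 + r)%N, (col_mx g (row_mx 0 B)); split; first by rewrite leq_add2l.
  move=> a b; rewrite -(hsubmxK a) -(hsubmxK b) !mul_row_col gE !mul_mx_row.
  rewrite !mulmx0 !add_row_mx !addr0 => /eq_row_mx[].
  rewrite !mul_mx_scalar => e1.
  have -> : lsubmx a = lsubmx b.
    apply/rowP => i; move/rowP/(_ i): e1; rewrite !mxE.
    exact: mulfI.
  by move=> /addrI/Binj ->.
move=> u; split=> [Lu|[a ->]]; last first.
  rewrite -(hsubmxK a) mul_row_col; apply: LD.
    by rewrite [lsubmx a]mx11_scalar mul_scalar_mx; exact: LZ.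
  by rewrite mul_mx_row mulmx0; apply/BL; exists (rsubmx a).
have : [set lsubmx u 0 0 | u in L] (lsubmx u 0 0) by exists u.
move=> /dL[z uz].
have w0 : lsubmx (u - z *: g) = 0.
  rewrite [LHS]mx11_scalar.
  have -> : lsubmx (u - z *: g) 0 0 = lsubmx u 0 0 - z * lsubmx g 0 0.
    by rewrite !mxE.
  by rewrite uz gd subrr raddf0.
have : L (u - z *: g) by apply: LB => //; exact: LZ.
rewrite -[X in L X]hsubmxK w0 => /BL[a au]; exists (row_mx z%:M a).
rewrite mul_row_col mul_scalar_mx mul_mx_row mulmx0 -au -w0 hsubmxK.
by rewrite addrC subrK.
Qed.

(** * Groups that permute charts and scale them by powers of a fixed number *)

Section ScalingCharts.
Context {R : realType} (X : set R) (K : set (sym X)) (m : nat).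
Context (e : 'I_m -> R -> R) (q : R).
Hypothesis q_gt1 : 1 < q.
Hypothesis K_subgroup : subgroup K.
Hypothesis e_in : forall j x, 0 <= x -> X (e j x).
Hypothesis e_cover : forall y, X y -> exists j, exists2 x, 0 <= x & y = e j x.
Hypothesis e_inj : forall i j x y, 0 <= x -> 0 <= y -> e i x = e j y ->
  i = j /\ x = y.

(** Charts are moved by a mere function [s]: finiteness of the set of such functions already bounds
    the index, so bijectivity need not be carried along. *)
Definition scales (g : sym X) (s : 'I_m -> 'I_m) (k : 'rV[int]_m) : Prop :=
  forall j x, 0 <= x -> graph g (e j x, e (s j) (q ^ k 0 j * x)).

Hypothesis K_scales : forall g, K g -> exists s k, scales g s k.

Let q_gt0 : 0 < q. Proof. exact: lt_trans q_gt1. Qed.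
Let qz_ge0 z x : 0 <= x -> 0 <= q ^ z * x.
Proof. by move=> x0; rewrite mulr_ge0// exprz_ge0// ltW. Qed.
Let qzM z z' x : q ^ z * (q ^ z' * x) = q ^ (z + z') * x.
Proof. by rewrite expfzDr ?gt_eqF// mulrA. Qed.

Lemma scales1 : scales 1%g id 0.
Proof.
move=> j x x0; rewrite mxE expr0z mul1r.
by exists (e j x) => //; exact: e_in.
Qed.

(** Elements that move the charts in the same way differ by one that preserves each chart; this is
    the source of the finite index. *)
Lemma scales_div g h s k l :
  scales g s k -> scales h s l -> scales (h^-1 * g)%g id (k - l).
Proof.
move=> gs hs j x x0; exists (e (s j) (q ^ k 0 j * x)); first exact: gs.
have /= := hs j _ (qz_ge0 (k 0 j - l 0 j) x0).
by rewrite qzM (addrC (l 0 j)) subrK !mxE.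
Qed.

Lemma scalesM g h k l :
  scales g id k -> scales h id l -> scales (g * h)%g id (k + l).
Proof.
move=> gs hs j x x0; exists (e j (q ^ l 0 j * x)); first exact: hs.
by have := gs j _ (qz_ge0 (l 0 j) x0); rewrite qzM mxE.
Qed.

(** The charts cover [X], so [s] and [k] prescribe every value. *)
Lemma scales_uniq g h s k : scales g s k -> scales h s k -> g = h.
Proof.
have sub g' h' : scales g' s k -> scales h' s k -> graph g' `<=` graph h'.
  move=> gs hs [y z] gyz; have [dg _ gf _] := graph_bij g'.
  have : X y by rewrite -dg; exists z.
  move=> /e_cover[j [x x0 yE]]; rewrite yE in gyz *.
  by rewrite (gf _ _ _ gyz (gs j x x0)); exact: hs.
by move=> gs hs; apply: sym_eq; apply/seteqP; split; exact: sub.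
Qed.

(** Evaluation at the chart coordinate 1 recovers each power of [q], and powers of [q > 1] determine
    their exponents. *)
Lemma scales_exp_uniq g s k l : scales g s k -> scales g s l -> k = l.
Proof.
move=> gk gl; apply/rowP => j; have [_ _ gf _] := graph_bij g.
have := gf _ _ _ (gk j 1 ler01) (gl j 1 ler01).
move=> /e_inj[||_]; try exact: qz_ge0.
by rewrite !mulr1 => /ieexprIz-> //; rewrite gt_eqF.
Qed.

Definition scaling_subgroup : set (sym X) :=
  [set g | K g /\ exists k, scales g id k].

Lemma scaling_subgroup_closed : subgroup scaling_subgroup.
Proof.
have [K1 KB] := K_subgroup.
split; first by rewrite in_setE; split; [rewrite -in_setE | exists 0; exact: scales1].
move=> g h; rewrite !in_setE => -[Kg [k gk]] [Kh [l hl]].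
split; first by rewrite -in_setE; apply: KB; rewrite in_setE.
exists (k - l); have := scales_div scales1 hl; rewrite mulg1 sub0r.
exact: scalesM.
Qed.

(** The coset of [g] depends only on the map [s] of the charts, for which there are finitely many
    choices. *)
Lemma scaling_subgroup_finite_index : finite_set (left_cosets K scaling_subgroup).
Proof.
have KM := group_closedM K_subgroup; have KV := group_closedV K_subgroup.
(* For a map [s] that no element of [K] induces, the value is the default 1, which only adds a coset
   to the finite set used as an upper bound. *)
pose rep (s : {ffun 'I_m -> 'I_m}) :=
  xget 1%g [set g | K g /\ exists k, scales g s k].
pose coset g := [set (g * h)%g | h in scaling_subgroup].
apply: (@sub_finite_set _ _ [set coset (rep s) | s in setT]); last first.
  exact/finite_image/finite_finset.
move=> _ [g Kg <-]; have [s [k gs]] := K_scales Kg.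
have gs' : scales g (finfun s) k by move=> j x x0; rewrite ffunE; exact: gs.
exists (finfun s) => //.
have [Kr [l rs]] : [set g | K g /\ exists k, scales g (finfun s) k] (rep (finfun s)).
  by apply: xgetPex; exists g; split=> //; exists k.
have sub g1 g2 k1 k2 : K g1 -> K g2 ->
    scales g1 (finfun s) k1 -> scales g2 (finfun s) k2 -> coset g1 `<=` coset g2.
  move=> K1 K2 gs1 gs2 _ [h [Kh [z hz]] <-].
  exists (g2^-1 * g1 * h)%g; last by rewrite !mulgA mulgV mul1g.
  split; last by exists (k1 - k2 + z); exact: scalesM (scales_div gs1 gs2) hz.
  rewrite -in_setE; apply: (KM); last by rewrite in_setE.
  by apply: KM; [apply: KV|]; rewrite in_setE.
by apply/seteqP; split; apply: sub; eassumption.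
Qed.

(** On the chart-preserving subgroup the exponent vector is an injective homomorphism. Its image [L]
    is a subgroup of the lattice of rank [m], hence free of rank at most [m]. *)
Lemma scaling_charts_virtually_free_abelian :
  virtually_free_abelian_of_rank_le m K.
Proof.
split=> //.
have KM := group_closedM K_subgroup; have KV := group_closedV K_subgroup.
pose L : set 'rV[int]_m := [set k | exists2 g, K g & scales g id k].
have [||r [B [rm Binj BL]]] := @subgroup_lattice_free m L.
- by exists 1%g; [rewrite -in_setE; exact: K_subgroup.1 | exact: scales1].
- move=> k l [g Kg gk] [h Kh hl]; exists (h^-1 * g)%g; last exact: scales_div gk hl.
  by rewrite -in_setE; apply: KM; [apply: KV|]; rewrite in_setE.
exists r, scaling_subgroup; split=> //; first exact: scaling_subgroup_closed.
- by move=> g [].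
- exact: scaling_subgroup_finite_index.
(* The inverse of the exponent map, in coordinates of the basis [B]. Since exponents determine the
   element, [phi] is additive and onto. *)
pose phi (a : 'rV[int]_r) := xget 1%g [set g | K g /\ scales g id (a *m B)].
have phiP a : K (phi a) /\ scales (phi a) id (a *m B).
  apply: (@xgetPex _ 1%g [set g | K g /\ scales g id (a *m B)]).
  have [_ ] := BL (a *m B); case; first by exists a.
  by move=> g Kg gs; exists g.
exists phi; first split.
- by move=> a _; have [Ka sa] := phiP a; split=> //; exists (a *m B).
- move=> a b _ _ ab; apply: Binj; apply: (@scales_exp_uniq (phi a) id).
    by have [] := phiP a.
  by rewrite ab; have [] := phiP b.
- move=> g [Kg [k gk]]; have [a ka] : exists a, k = a *m B by apply/BL; exists g.
  exists a => //; have [_] := phiP a; rewrite -ka => /scales_uniq; exact.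
move=> a b; have [_ sa] := phiP a; have [_ sb] := phiP b.
have [_] := phiP (a + b); rewrite mulmxDl => /scales_uniq; apply.
exact: scalesM.
Qed.

End ScalingCharts.

(** * Partial maps with domains open to the right *)

Section PartialMapFacts.
Context {R : realType}.
Implicit Types (f g : parmap R) (D P : set R).

Lemma parmap_ofE P (F : R -> R) x y : parmap_of P F (x, y) <-> P x /\ y = F x.
Proof. by split=> [[z Pz [<- <-]]|[Px ->]] //; exists x. Qed.

Lemma pdom_parmap_of P (F : R -> R) : pdom (parmap_of P F) = P.
Proof.
apply/seteqP; split=> x => [[y /parmap_ofE[]]//|Px].
by exists (F x); exact/parmap_ofE.
Qed.

Lemma pinv_pcomp f g : pinv (pcomp g f) = pcomp (pinv f) (pinv g).
Proof. by apply/seteqP; split=> -[z x] /= [y]; exists y. Qed.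

Lemma prestrict_pcomp f g D : prestrict (pcomp g f) D = pcomp g (prestrict f D).
Proof.
apply/seteqP; split=> -[x y] /=; first by move=> [[z a b] Dx]; exists z.
by move=> [z [a Dx] b]; split=> //; exists z.
Qed.

Lemma papplyE f x y : (forall z, f (x, z) -> z = y) -> f (x, y) -> papply f x = y.
Proof.
move=> fu fxy; apply: fu.
exact: (@xgetPex _ 0 [set z | f (x, z)]) (ex_intro _ y fxy).
Qed.

Lemma I01E (x : R) : I01 x <-> 0 <= x < 1.
Proof. by rewrite /I01 /= in_itv. Qed.

Lemma halflineE (a x : R) : halfline a x <-> a <= x.
Proof. by rewrite /halfline /= in_itv /= andbT. Qed.

Definition right_open f : Prop := forall x y, f (x, y) ->
  exists2 eps, 0 < eps & forall x', x <= x' < x + eps -> pdom f x'.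

Lemma right_open_I01 (F : R -> R) : right_open (parmap_of I01 F).
Proof.
move=> x y /parmap_ofE[/I01E/andP[x0 x1] _]; exists (1 - x); first lra.
by move=> x' xx'; rewrite pdom_parmap_of; apply/I01E; lra.
Qed.

(** The hypotheses on [G] make the image exactly [l, u), which is open to the right. *)
Lemma right_open_pinv_I01 (F G : R -> R) (l u : R) :
  (forall x, I01 x -> l <= F x < u) ->
  (forall y, l <= y < u -> I01 (G y) /\ F (G y) = y) ->
  right_open (pinv (parmap_of I01 F)).
Proof.
move=> FI GI y x /parmap_ofE/= [/FI/andP[Fl Fu] ->]; exists (u - F x); first lra.
move=> y' yy'; have [|IG FG] := GI y'; first lra.
by exists (G y'); apply/parmap_ofE; split.
Qed.

End PartialMapFacts.

(** * Partial Moebius maps with integer matrices *)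

Section Mobius.
Context {R : realType} (n : nat).
Implicit Types f g : parmap R.

(** The formula constrains only points of the graph, so restrictions inherit it. Positivity of the
    denominator fixes the sign of the matrix and makes the map increasing. *)
Definition mobius f : Prop :=
  exists (a b c d : int) (k : nat), a * d - b * c = (n ^ k)%:Z /\
    forall x y, f (x, y) ->
      0 < c%:~R * x + d%:~R /\ y * (c%:~R * x + d%:~R) = a%:~R * x + b%:~R.

Hypothesis n_gt0 : (0 < n)%N.

(** Matrices multiply, and the denominator of the composite is the product of the two denominators,
    hence positive. *)
Lemma mobius_pcomp f g : mobius f -> mobius g -> mobius (pcomp g f).
Proof.
move=> [a [b [c [d [k [fdet fP]]]]]] [a' [b' [c' [d' [k' [gdet gP]]]]]].
exists (a' * a + b' * c), (a' * b + b' * d), (c' * a + d' * c), (c' * b + d' * d).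
exists (k' + k)%N; split; first by rewrite expnD PoszM -fdet -gdet; ring.
move=> x z [y /= /fP[den1 e1] /gP[den2 e2]].
have E1 : (c' * a + d' * c)%:~R * x + (c' * b + d' * d)%:~R =
    (c'%:~R * y + d'%:~R) * (c%:~R * x + d%:~R) :> R.
  by rewrite !(intrD, intrM) [RHS]mulrDl -[_ * y * _]mulrA e1; ring.
have E2 : (a' * a + b' * c)%:~R * x + (a' * b + b' * d)%:~R =
    (a'%:~R * y + b'%:~R) * (c%:~R * x + d%:~R) :> R.
  by rewrite !(intrD, intrM) [RHS]mulrDl -[_ * y * _]mulrA e1; ring.
by rewrite E1 E2 -e2 mulrA; split=> //; exact: mulr_gt0.
Qed.

Lemma mobius_det_gt0 (a b c d : int) (k : nat) :
  a * d - b * c = (n ^ k)%:Z -> 0 < (a%:~R * d%:~R - b%:~R * c%:~R : R).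
Proof.
by move=> e; rewrite -!intrM -intrB e ltr0z ltz_nat expn_gt0 n_gt0.
Qed.

(** The adjugate matrix works: its denominator at [y] times that of [f] at [x] is the determinant,
    which is positive. *)
Lemma mobius_pinv f : mobius f -> mobius (pinv f).
Proof.
move=> [a [b [c [d [k [fdet fP]]]]]].
exists d, (- b), (- c), a, k; split; first by rewrite -fdet; ring.
move=> y x /fP/= [den e]; have det := mobius_det_gt0 fdet.
rewrite !intrN.
have E : (- c%:~R * y + a%:~R) * (c%:~R * x + d%:~R) =
    a%:~R * d%:~R - b%:~R * c%:~R :> R.
  by rewrite mulrDl -[_ * y * _]mulrA e; ring.
split; first by rewrite -(pmulr_lgt0 _ den) E.
apply: (mulIf (lt0r_neq0 den)); rewrite -mulrA E mulrDl -[_ * y * _]mulrA e; ring.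
Qed.

Lemma mobius_fun f x y y' : mobius f -> f (x, y) -> f (x, y') -> y = y'.
Proof.
move=> [a [b [c [d [k [_ fP]]]]]] /fP[den e] /fP[_ e'].
by apply: (mulIf (lt0r_neq0 den)); rewrite e e'.
Qed.

Lemma mobius_inj f x x' y : mobius f -> f (x, y) -> f (x', y) -> x = x'.
Proof. by move=> /mobius_pinv; exact: mobius_fun. Qed.

(** Positive determinant keeps points right of [x] right of [y], so that one-sided neighbourhoods
    can be pulled back through compositions. *)
Lemma mobius_right_continuous f x y (eps : R) : mobius f -> f (x, y) -> 0 < eps ->
  exists2 del, 0 < del & forall x' y', f (x', y') -> x <= x' < x + del ->
    y <= y' < y + eps.
Proof.
move=> [a [b [c [d [k [fdet fP]]]]]] /fP[den e] eps0.
have det := mobius_det_gt0 fdet.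
set D := a%:~R * d%:~R - b%:~R * c%:~R in det; set q := c%:~R * x + d%:~R in den e.
(* [y' - y = D (x' - x) / (q q')] where [q' >= q / 2] *)
pose N := `|c%:~R : R|.
have N0 : 0 <= N by rewrite normr_ge0.
have cN : - N <= c%:~R by rewrite lerNl /N -normrN ler_norm.
(* The first bound gives [q' >= q / 2], with [N + 1] in place of [N] because [c] may be 0; the
   second then makes the increment smaller than [eps]. *)
pose del := Num.min (q / (2 * (N + 1))) (eps * (q * q) / (2 * D)).
have N1 : 0 < N + 1 by lra.
exists del => [|x' y' /fP[den' e'] /andP[xx']].
  by rewrite lt_min !divr_gt0 ?mulr_gt0.
rewrite -ltrBlDl lt_min => /andP[]; set t := x' - x.
have t0 : 0 <= t by rewrite subr_ge0.
rewrite !ltr_pdivlMr ?mulr_gt0// => t1 t2.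
set q' := c%:~R * x' + d%:~R in den' e'.
have q'E : q' = q + c%:~R * t by rewrite /q' /q /t; ring.
have q'2 : q <= 2 * q'.
  rewrite q'E; have : - N * t <= c%:~R * t by exact: ler_wpM2r.
  have : 0 <= N * t by exact: mulr_ge0.
  by nra.
have E : (y' - y) * (q * q') = D * t.
  have -> : (y' - y) * (q * q') = (y' * q') * q - (y * q) * q' by ring.
  by rewrite e e' /D /q /q' /t; ring.
have qq : 0 < q * q' by exact: mulr_gt0.
apply/andP; split.
  by rewrite -subr_ge0 -(pmulr_lge0 _ qq) E mulr_ge0// ltW.
rewrite -ltrBlDl -(ltr_pM2r qq) E.
have : q * q * eps <= 2 * (q * q') * eps.
  by rewrite ler_pM2r// mulrCA ler_pM2l.
by nra.
Qed.

Hypothesis n_prime : prime n.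

Lemma mobius_halfline f :
  mobius f -> pdom f = halfline 0 -> pimage f (halfline 0) = halfline 0 ->
  exists k : int, forall x, 0 <= x -> f (x, n%:R ^ k * x).
Proof.
move=> [a [b [c [d [k [fdet fP]]]]]] df If.
have val x : 0 <= x -> exists2 y, 0 <= y & f (x, y).
  move=> x0; have [y fxy] : pdom f x by rewrite df; exact/halflineE.
  by exists y => //; apply/halflineE; rewrite -If; exists x => //; exact/halflineE.
have surj y : 0 <= y -> exists2 x, 0 <= x & f (x, y).
  by move=> /halflineE; rewrite -{1}If => -[x /halflineE]; exists x.
have det := mobius_det_gt0 fdet.
have d0 : 0 < d%:~R :> R.
  by have [y _ /fP[]] := val 0 (lexx _); rewrite mulr0 add0r.
(* Otherwise the pole -d/c would be a point of the half-line. *)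
have c0 : 0 <= c%:~R :> R.
  rewrite leNgt; apply/negP => c_lt0.
  have [|y _ /fP[]] := val (- d%:~R / c%:~R).
    by rewrite mulNr -mulrN -invrN divr_ge0// ?oppr_ge0 ltW.
  by rewrite mulrCA divff ?lt_eqF// mulr1 addNr ltxx.
have b_ge0 : 0 <= b%:~R :> R.
  have [y y0 /fP[_]] := val 0 (lexx _).
  by rewrite !mulr0 !add0r => <-; rewrite mulr_ge0// ltW.
(* If b > 0, attaining the value 0 forces a < 0, and then ad - bc < 0. *)
have b0 : b%:~R = 0 :> R.
  apply/eqP; rewrite eq_le b_ge0 andbT leNgt; apply/negP => b_gt0.
  have [x x0 /fP[_]] := surj 0 (lexx _); rewrite mul0r => /esym ax.
  have a0 : a%:~R < 0 :> R.
    by rewrite ltNge; apply/negP => a0; have := mulr_ge0 a0 x0; lra.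
  have : a%:~R * d%:~R < 0 :> R by rewrite nmulr_rlt0.
  by have := mulr_ge0 b_ge0 c0; lra.
have a0 : 0 < a%:~R :> R.
  by rewrite b0 mul0r subr0 in det; rewrite -(pmulr_lgt0 _ d0).
(* If c > 0, the value a/c is the limit at infinity and is attained at no finite point. *)
have c00 : c%:~R = 0 :> R.
  apply/eqP; rewrite eq_le c0 andbT leNgt; apply/negP => c_gt0.
  have [|x x0 /fP[_]] := surj (a%:~R / c%:~R); first by rewrite divr_ge0// ltW.
  rewrite b0 addr0 mulrDr mulrA divfK ?gt_eqF// -[RHS]addr0 => /addrI/eqP.
  by rewrite !mulf_eq0 invr_eq0 !gt_eqF.
(* Now ad is a power of the prime [n], so each factor is one as well. *)
have adE : (`|a| * `|d| = n ^ k)%N.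
  move/eqP: b0; rewrite intr_eq0 => /eqP b0; rewrite b0 mul0r subr0 in fdet.
  by rewrite -abszM fdet.
rewrite !ltr0z in a0 d0.
have /(dvdn_pfactor _ _ n_prime)[i _ ai] : (`|a| %| n ^ k)%N.
  by rewrite -adE dvdn_mulr.
have /(dvdn_pfactor _ _ n_prime)[j _ dj] : (`|d| %| n ^ k)%N.
  by rewrite -adE dvdn_mull.
exists (i%:Z - j%:Z) => x x0; have [y _ fxy] := val x x0.
suff -> : n%:R ^ (i%:Z - j%:Z) * x = y by [].
have n0 : n%:R != 0 :> R by rewrite pnatr_eq0 -lt0n.
have aE : a%:~R = n%:R ^+ i :> R by rewrite -natrX -ai natr_absz gtr0_norm.
have dE : d%:~R = n%:R ^+ j :> R by rewrite -natrX -dj natr_absz gtr0_norm.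
have [_] := fP _ _ fxy; rewrite c00 b0 mul0r add0r addr0 aE dE => yE.
rewrite expfzDr// -exprnP -exprnN mulrAC -yE mulfK//.
by rewrite expf_neq0.
Qed.

End Mobius.

(** * The semigroup and the charts of its generating domains *)

Section Semigroup.
Context {R : realType} (n : nat) (primed : bool).
Hypothesis n_gt0 : (0 < n)%N.
Implicit Types (f g : parmap R) (D P : set R).

Lemma semigrp_pcomp f g :
  semigrp n primed f -> semigrp n primed g -> semigrp n primed (pcomp g f).
Proof.
by move=> Sf Sg M MP; case: (MP) => -[MC _] _; apply: MC; [exact: Sf|exact: Sg].
Qed.

Lemma semigrp_pinv f : semigrp n primed f -> semigrp n primed (pinv f).
Proof. by move=> Sf M MP; case: (MP) => -[_ MV] _; apply: MV; exact: Sf. Qed.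

Lemma generators_semigrp f : generators n primed f -> semigrp n primed f.
Proof. exact: sub_gen_smallest. Qed.

Lemma generators_ind (Q : parmap R -> Prop) :
  Q mapA -> Q mapB -> Q (mapC n) -> (primed -> Q mapT) ->
  forall g, generators n primed g -> Q g.
Proof.
move=> QA QB QC QT g [[[->|->]|->]|] //.
by case: primed QT => // QT ->; exact: QT.
Qed.

Lemma generators_mobius g : generators n primed g -> mobius n g.
Proof.
move: g; apply: generators_ind => [||| _].
- exists 1, 0, 1, 1, 0%N; split=> // x y /parmap_ofE[/I01E/andP[x0 x1] ->].
  by split; [lra | field; lra].
- exists 0, 1, (-1), 2, 0%N; split=> // x y /parmap_ofE[/I01E/andP[x0 x1] ->].
  by split; [lra | field; lra].
(* The only generator whose matrix has determinant [n] instead of 1. *)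
- exists n%:Z, 0, (n%:Z - 1), 1, 1%N; split; first by rewrite expn1; ring.
  move=> x y /parmap_ofE[/I01E/andP[x0 x1] ->].
  have n1 : 1 <= n%:R :> R by rewrite ler1n.
  rewrite intrB -!pmulrn.
  have den : 0 < (n%:R - 1) * x + 1 by nra.
  by split=> //; field; exact: lt0r_neq0.
- exists 1, 1, 0, 1, 0%N; split=> // x y /parmap_ofE[_ ->].
  by split; [lra | ring].
Qed.

Lemma generators_right_open g :
  generators n primed g -> right_open g /\ right_open (pinv g).
Proof.
have n1 : 1 <= n%:R :> R by rewrite ler1n.
move: g; apply: generators_ind => [||| _]; (split; first try exact: right_open_I01).
- apply: (@right_open_pinv_I01 _ _ (fun y => y / (1 - y)) 0 (1 / 2)).
    move=> x /I01E/andP[x0 x1]; have d : 0 < x + 1 by lra.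
    by rewrite divr_ge0 ?(ltW d)// ltr_pdivrMr//; lra.
  move=> y /andP[y0 y1]; have d : 0 < 1 - y by lra.
  split; last by field; lra.
  by apply/I01E; rewrite divr_ge0 ?(ltW d)// ltr_pdivrMr//; lra.
- apply: (@right_open_pinv_I01 _ _ (fun y => 2 - 1 / y) (1 / 2) 1).
    move=> x /I01E/andP[x0 x1]; have d : 0 < 2 - x by lra.
    by rewrite ler_pdivlMr// ltr_pdivrMr//; lra.
  move=> y /andP[y0 y1]; have d : 0 < y by lra.
  split; last by field; lra.
  apply/I01E; have : 1 / y <= 2 by rewrite ler_pdivrMr//; lra.
  have : 1 < 1 / y by rewrite ltr_pdivlMr//; lra.
  by lra.
- apply: (@right_open_pinv_I01 _ _ (fun y => y / (n%:R - (n%:R - 1) * y)) 0 1).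
    move=> x /I01E/andP[x0 x1]; have d : 0 < (n%:R - 1) * x + 1 by nra.
    by rewrite divr_ge0 ?(ltW d) ?mulr_ge0// ltr_pdivrMr//; nra.
  move=> y /andP[y0 y1]; have d : 0 < n%:R - (n%:R - 1) * y by nra.
  split; last by field; nra.
  by apply/I01E; rewrite divr_ge0 ?(ltW d)// ltr_pdivrMr//; nra.
- move=> x y /parmap_ofE[/halflineE x0 _]; exists 1 => // x' xx'.
  by rewrite pdom_parmap_of; apply/halflineE; lra.
- move=> y x /parmap_ofE/= [/halflineE x0 ->]; exists 1 => // y' yy'.
  by exists (y' - 1); apply/parmap_ofE; split=> /=; [apply/halflineE; lra | ring].
Qed.

(** Right continuity and monotonicity of [f] send a small right neighbourhood of [x] into the one on
    which [g] is defined. *)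
Lemma right_open_pcomp f g :
  mobius n f -> right_open f -> right_open g -> right_open (pcomp g f).
Proof.
move=> mf of_ og x z [y /= fxy gyz].
have [e1 e10 dom1] := of_ _ _ fxy; have [e2 e20 dom2] := og _ _ gyz.
have [e3 e30 cont] := mobius_right_continuous n_gt0 mf fxy e20.
exists (Num.min e1 e3); first by rewrite lt_min e10.
move=> x' /andP[xx']; rewrite -ltrBlDl lt_min !ltrBlDl => /andP[x1 x3].
have [|y' fxy'] := dom1 x'; first by rewrite xx'.
have [|z' gyz'] := dom2 y'; first by apply: cont fxy' _; rewrite xx'.
by exists z', y'.
Qed.

(** Both [f] and its inverse are tracked, since the semigroup is closed under inversion and the
    image must be open to the right too. *)
Lemma semigrp_mobius_right_open f : semigrp n primed f ->
  [/\ mobius n f, right_open f & right_open (pinv f)].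
Proof.
move: f; apply: smallest_sub; last first.
  move=> f gf; have [] := generators_right_open gf; split=> //.
  exact: generators_mobius.
split=> [f g [mf of_ ofi] [mg og ogi]|f [mf of_ ofi]]; last first.
  by split=> //; exact: mobius_pinv.
split; [exact: mobius_pcomp|exact: right_open_pcomp|].
by rewrite pinv_pcomp; apply: right_open_pcomp => //; exact: mobius_pinv.
Qed.

Lemma semigrp_mobius f : semigrp n primed f -> mobius n f.
Proof. by case/semigrp_mobius_right_open. Qed.

Lemma pcomp_pinvl f : mobius n f -> pcomp (pinv f) f = parmap_of (pdom f) id.
Proof.
move=> mf; apply/seteqP; split=> -[x x'] /=.
  move=> [y /= fxy fxy']; apply/parmap_ofE; split; first by exists y.
  exact/esym/(mobius_inj n_gt0 mf fxy fxy').
by move=> /parmap_ofE[[y fxy] ->]; exists y.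
Qed.

Lemma semigrp_id_pdom f :
  semigrp n primed f -> semigrp n primed (parmap_of (pdom f) id).
Proof.
move=> Sf; rewrite -pcomp_pinvl; last exact: semigrp_mobius.
by apply: semigrp_pcomp => //; exact: semigrp_pinv.
Qed.

(** Words and shifts are built one generator at a time. Inclusion in I or in the half-line is
    carried along, so that the next generator is defined on the whole set. *)
Lemma Dgen_ind (Q : set R -> Prop) :
  Q I01 -> (primed -> Q (halfline 0)) ->
  (forall D g, generators n primed g -> D `<=` pdom g -> Q D -> Q (pimage g D)) ->
  forall D, Dgen primed D -> Q D.
Proof.
move=> QI QH QS.
have gA : generators n primed mapA by left; left; left.
have gB : generators n primed mapB by left; left; right.
have word w : (word_image w : set R) `<=` I01 /\ Q (word_image w).
  elim: w => [|b w [wI Qw]]; first by split.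
  case: b; split.
  - move=> y [x _ /parmap_ofE[/I01E/andP[x0 x1] ->]]; apply/I01E.
    have d : 0 < x + 1 by lra.
    by rewrite divr_ge0 ?(ltW d)// ltr_pdivrMr//; lra.
  - by apply: QS => //; rewrite pdom_parmap_of.
  - move=> y [x _ /parmap_ofE[/I01E/andP[x0 x1] ->]]; apply/I01E.
    have d : 0 < 2 - x by lra.
    by rewrite divr_ge0 ?(ltW d)// ltr_pdivrMr//; lra.
  - by apply: QS => //; rewrite pdom_parmap_of.
rewrite /Dgen; case: primed QH QS {gA gB} => QH QS D; last first.
  by case=> w ->; case: (word w).
have gT : generators n true mapT by right.
case=> [[k [w ->]]|[k ->]].
  suff [] : iter k (pimage mapT) (word_image w : set R) `<=` halfline 0 /\
      Q (iter k (pimage mapT) (word_image w)) by [].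
  elim: k => [|k [IH Qk]] /=; split.
  - by case: (word w) => wI _ x /wI/I01E/andP[x0 _]; exact/halflineE.
  - by case: (word w).
  - move=> y [x _ /parmap_ofE[/halflineE x0 ->]]; apply/halflineE; lra.
  - by apply: QS => //; rewrite pdom_parmap_of.
elim: k => [|k IH]; first exact: QH.
have -> : halfline k.+1%:R = pimage mapT (halfline k%:R) :> set R.
  apply/seteqP; split=> y.
    move=> /halflineE ky; exists (y - 1).
      by apply/halflineE; rewrite -natr1 in ky; lra.
    apply/parmap_ofE; split; last by ring.
    by apply/halflineE; rewrite -natr1 in ky; have := ler0n R k; lra.
  by move=> [x /halflineE kx /parmap_ofE[_ ->]]; apply/halflineE; rewrite -natr1; lra.
apply: QS => //; rewrite pdom_parmap_of => x /halflineE kx.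
by apply/halflineE; have := ler0n R k; lra.
Qed.

(** Domains of elements carry the idempotents [pcomp (pinv f) f], and an image under a generator is
    the domain of an inverse. *)
Lemma semigrp_id_Dgen D : Dgen primed D -> semigrp n primed (parmap_of D id).
Proof.
move: D; apply: Dgen_ind.
- have := @semigrp_id_pdom mapA; rewrite pdom_parmap_of; apply.
  by apply: generators_semigrp; left; left; left.
- move=> pr; have := @semigrp_id_pdom mapT; rewrite pdom_parmap_of; apply.
  by apply: generators_semigrp; right; rewrite pr.
move=> D g /generators_semigrp Sg Dg SD.
have -> : pimage g D = pdom (pinv (pcomp g (parmap_of D id))).
  apply/seteqP; split=> [y [x Dx gxy]|y [x /= [x' /parmap_ofE[Dx /= ->] gxy]]].
    by exists x; exists x => //; exact/parmap_ofE.
  by exists x.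
by apply: semigrp_id_pdom; apply: semigrp_pinv; exact: semigrp_pcomp.
Qed.

(* [x |-> x / (x + 1)] identifies [0, +oo) with [0, 1), so that both kinds of
   sets in [Dgen] are modelled on the half-line, where the Moebius
   self-bijections are linear. *)
Lemma Dgen_chart D : Dgen primed D -> exists w : parmap R,
  [/\ mobius n w, pdom w = halfline 0 & pimage w (halfline 0) = D].
Proof.
move: D; apply: Dgen_ind.
- exists (parmap_of (halfline 0) (fun x => x / (x + 1))); split.
  + exists 1, 0, 1, 1, 0%N; split=> // x y /parmap_ofE[/halflineE x0 ->].
    by split; [lra | field; lra].
  + by rewrite pdom_parmap_of.
  apply/seteqP; split=> [y [x _ /parmap_ofE[/halflineE x0 ->]]|y].
    have d : 0 < x + 1 by lra.
    by apply/I01E; rewrite divr_ge0 ?(ltW d)// ltr_pdivrMr//; lra.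
  move=> /I01E/andP[y0 y1]; have d : 0 < 1 - y by lra.
  have x0 : halfline 0 (y / (1 - y)) by apply/halflineE; rewrite divr_ge0 ?(ltW d).
  by exists (y / (1 - y)) => //; apply/parmap_ofE; split=> //; field; lra.
- move=> _; exists (parmap_of (halfline 0) id); split.
  + exists 1, 0, 0, 1, 0%N; split=> // x y /parmap_ofE[_ ->].
    by split; [lra | ring].
  + by rewrite pdom_parmap_of.
  apply/seteqP; split=> [y [x _ /parmap_ofE[x0 ->]]//|y y0].
  by exists y => //; exact/parmap_ofE.
move=> D g gg Dg [w [mw dw Iw]]; exists (pcomp g w); split.
- by apply: mobius_pcomp => //; exact: generators_mobius.
- apply/seteqP; split=> [x [z [y /= wxy _]]|x]; first by rewrite -dw; exists y.
  move=> x0; have [y wxy] : pdom w x by rewrite dw.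
  have [|z gyz] := Dg y; first by rewrite -Iw; exists x.
  by exists z, y.
apply/seteqP; split=> [z [x x0 [y /= wxy gyz]]|z [y]].
  by exists y => //; rewrite -Iw; exists x.
by rewrite -{1}Iw => -[x x0 wxy] gyz; exists x => //; exists y.
Qed.

End Semigroup.

(** * Piecewise maps, the group V(S) and its action on classes *)

Section Piecewise.
Context {R : realType} (n : nat) (primed : bool).
Hypothesis n_gt0 : (0 < n)%N.
Implicit Types (f g : parmap R) (D : set R) (p q : parmap R * set R).

Local Notation X := (@Xspace R primed).
Local Notation S := (semigrp n primed).

(** A form convenient for constructions: empty pieces are allowed and are discarded when the
    partition is rebuilt. *)
Lemma ShatP f : Shat n primed f <->
  [/\ forall x y, f (x, y) -> X x /\ X y,
      forall x y y', f (x, y) -> f (x, y') -> y = y',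
      forall x x' y, f (x, y) -> f (x', y) -> x = x' &
      exists Ds : set (set R), [/\ finite_set Ds,
        forall x, pdom f x -> exists2 D, Ds D & D x,
        forall D D' x, Ds D -> Ds D' -> D x -> D' x -> D = D',
        forall D, Ds D -> D `<=` pdom f &
        forall D, Ds D -> S (prestrict f D)]].
Proof.
split=> [[P [Q [PX QX [df If ff fi] [Ds [Dfin DD [Dcov Dtriv Dn] DS]]]]]|].
  split=> //.
    move=> x y fxy; have Px : P x by rewrite -df; exists y.
    by split; [exact: PX | apply: QX; rewrite -If; exists x].
  exists Ds; split=> //.
  - by rewrite df -Dcov => x [D DD' Dx]; exists D.
  - by move=> D D' x DsD DsD' Dx D'x; apply: Dtriv => //; exists x.
  - by move=> D DsD x Dx; rewrite df -Dcov; exists D.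
move=> [fX ff fi [Ds [Dfin Dcov Dtriv Ddom DS]]].
exists (pdom f), (pimage f (pdom f)); split=> //.
- by move=> x [y /fX[]].
- by move=> y [x _ /fX[]].
exists (Ds `&` [set D | D !=set0]); split.
- by apply: sub_finite_set Dfin => D [].
- move=> D [DsD Dn]; split=> //; exists (prestrict f D); first exact: DS.
  apply/seteqP; split=> [x Dx|x [y []]//].
  by have [y fxy] := Ddom D DsD x Dx; exists y.
- split.
  + apply/seteqP; split=> [x [D [DsD _] Dx]|x /Dcov[D DsD Dx]]; first exact: (Ddom D).
    by exists D => //; split=> //; exists x.
  + by move=> D D' [DsD _] [DsD' _] [x [Dx D'x]]; apply: Dtriv Dx D'x.
  + by move=> D [].
by move=> D [DsD _]; exact: DS.
Qed.

(** The pieces are the parts of each [D] that [f] sends into some [E]. *)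
Lemma Shat_pcomp f g : Shat n primed f -> Shat n primed g ->
  Shat n primed (pcomp g f).
Proof.
move=> /ShatP[fX ff fi [Ds [Dfin Dcov Dtriv Ddom DS]]].
move=> /ShatP[gX gf gi [Es [Efin Ecov Etriv Edom ES]]].
apply/ShatP; split.
- by move=> x z [y /= /fX[Xx _] /gX[]].
- by move=> x z z' [y /= a b] [y' /= /(ff _ _ _ a) <-]; exact: gf.
- move=> x x' z [y /= a b] [y' /= a' /(gi _ _ _ b) e].
  by move: a'; rewrite -e; exact: fi.
exists [set pdom (pcomp (prestrict g E) (prestrict f D)) | D in Ds & E in Es]; split.
- exact: finite_image2.
- move=> x [z [y /= fxy gyz]]; have [|D DsD Dx] := Dcov x; first by exists y.
  have [|E EsE Ey] := Ecov y; first by exists z.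
  exists (pdom (pcomp (prestrict g E) (prestrict f D))); last by exists z, y.
  by exists D => //; exists E.
- move=> _ _ x [D DsD [E EsE <-]] [D' DsD' [E' EsE' <-]].
  move=> [z [y /= [/= fxy Dx] [/= gyz Ey]]] [z' [y' /= [/= fxy' D'x] [/= gyz' E'y]]].
  rewrite (Dtriv D D' x)// (Etriv E E' y)//.
  by rewrite (ff _ _ _ fxy fxy').
- by move=> _ [D DsD [E EsE <-]] x [z [y /= [/= fxy Dx] [/= gyz Ey]]]; exists z, y.
- move=> _ [D DsD [E EsE <-]].
  have -> : prestrict (pcomp g f) (pdom (pcomp (prestrict g E) (prestrict f D))) =
      pcomp (prestrict g E) (prestrict f D).
    apply/seteqP; split=> -[x z].
      move=> [[y /= fxy gyz] [z' [y' /= [/= fxy' Dx] [/= gyz' Ey]]]].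
      by rewrite -(ff _ _ _ fxy fxy') in Ey; exists y.
    move=> [y /= [/= fxy Dx] [/= gyz Ey]]; split; first by exists y.
    by exists z, y.
  by apply: semigrp_pcomp; [exact: DS | exact: ES].
Qed.

Lemma Shat_pinv f : Shat n primed f -> Shat n primed (pinv f).
Proof.
move=> /ShatP[fX ff fi [Ds [Dfin Dcov Dtriv Ddom DS]]]; apply/ShatP; split.
- by move=> y x /fX[].
- by move=> y x x' /=; exact: fi.
- by move=> y y' x /=; exact: ff.
exists [set pimage f D | D in Ds]; split.
- exact: finite_image.
- move=> y [x /= fxy]; have [|D DsD Dx] := Dcov x; first by exists y.
  by exists (pimage f D); [exists D | exists x].
- move=> _ _ y [D DsD <-] [D' DsD' <-] [x Dx fxy] [x' D'x fxy'].
  by rewrite (Dtriv D D' x)//; rewrite (fi _ _ _ fxy fxy').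
- by move=> _ [D DsD <-] y [x Dx fxy]; exists x.
- move=> _ [D DsD <-].
  have -> : prestrict (pinv f) (pimage f D) = pinv (prestrict f D).
    apply/seteqP; split=> -[y x] /=; rewrite /prestrict /=.
      by move=> [fxy [x' Dx' fxy']]; rewrite (fi x x' y).
    by move=> [/= fxy Dx]; split=> //; exists x.
  by apply: semigrp_pinv; exact: DS.
Qed.

Lemma Xspace_Dgen : Dgen primed X.
Proof.
rewrite /Dgen /Xspace; case: primed; last by exists [::].
by right; exists 0%N.
Qed.

Lemma Shat_id : Shat n primed (parmap_of X id).
Proof.
have [dX _ Xf Xi] := bijection_pid X.
apply/ShatP; split=> //; first by move=> x y /parmap_ofE[? ->].
exists [set X]; split; first exact: finite_set1.
- by rewrite dX => x Xx; exists X.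
- by move=> D D' x -> ->.
- by move=> D ->; rewrite dX.
move=> D ->; have -> : prestrict (parmap_of X id) X = parmap_of X id.
  by apply/seteqP; split=> -[x y] => [[]//|h]; split=> //; case/parmap_ofE: h.
exact: (semigrp_id_Dgen n_gt0 Xspace_Dgen).
Qed.

(** The piece containing [x] also contains a right neighbourhood of [x], so the limit is that of a
    single Moebius map. *)
Lemma Shat_right_continuous f : Shat n primed f -> pdom f = X ->
  right_continuous_on X f.
Proof.
move=> /ShatP[fX ff fi [Ds [_ Dcov _ Ddom DS]]] df x; rewrite -{1}df => fx.
have [D DsD Dx] := Dcov x fx; case: fx => y fxy.
have val x' y' : f (x', y') -> papply f x' = y'.
  by move=> h; apply: papplyE => // z hz; exact: ff hz h.
have [mob ro _] := semigrp_mobius_right_open n_gt0 (DS D DsD).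
have rxy : prestrict f D (x, y) by [].
have [d1 d10 dom] := ro _ _ rxy.
apply/cvgrPdist_le => eps eps0; rewrite (val _ _ fxy).
have [d2 d20 cont] := mobius_right_continuous n_gt0 mob rxy eps0.
near=> x'.
have xx' : x < x' by near: x'; exact: nbhs_right_gt.
have x1 : x' < x + d1 by near: x'; apply: nbhs_right_lt; rewrite ltrDl.
have x2 : x' < x + d2 by near: x'; apply: nbhs_right_lt; rewrite ltrDl.
have [|y' fxy'] := dom x'; first by rewrite ltW.
have /andP[y1 y2] : y <= y' < y + eps by apply: cont fxy' _; rewrite ltW.
rewrite (val x' y' fxy'.1) ler_norml; lra.
Unshelve. all: by end_near.
Qed.

Lemma VgroupP (gam : sym X) : Vgroup n primed gam <-> Shat n primed gam.
Proof.
split=> [[]//|Sg]; split=> //; apply: Shat_right_continuous => //.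
by have [] := graph_bij gam.
Qed.

Lemma cls_refl p : marked n primed p -> cls n primed p p.
Proof.
move=> mp; split=> //; case: mp => _ gp pd.
exists (parmap_of p.2 id); first split.
- exact: semigrp_id_Dgen.
- exact: pdom_parmap_of.
- apply/seteqP; split=> [y [x Dx /parmap_ofE[_ ->]]//|y Dy].
  by exists y => //; exact/parmap_ofE.
apply/seteqP; split=> -[x y].
  by move=> [/= fxy Dx]; exists x => //; exact/parmap_ofE.
by move=> [x' /parmap_ofE/= [Dx ->] fxy].
Qed.

Lemma pcomp_symK (gam : sym X) f : (forall x y, f (x, y) -> X y) ->
  pcomp (gam^-1)%g (pcomp gam f) = f.
Proof.
have [dg Ig gf gi] := graph_bij gam => fX.
apply/seteqP; split=> -[x y] /=.
  by move=> [z /= [y' /= fxy' gyz] gyz']; rewrite (gi y y' z).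
move=> fxy; have [z gyz] : pdom gam y by rewrite dg; exact: fX fxy.
by exists z => //; exists y.
Qed.

Lemma marked_X p : marked n primed p -> forall x y, p.1 (x, y) -> X y.
Proof. by move=> [/ShatP[fX _ _ _] _ _] x y /fX[]. Qed.
Arguments marked_X [p] _ x y _.

Lemma marked_pcomp (gam : sym X) p : Vgroup n primed gam -> marked n primed p ->
  marked n primed (pcomp gam p.1, p.2).
Proof.
move=> /VgroupP Sg mp; have pX := marked_X mp; case: mp => Sp gp pd.
split=> //=; first exact: Shat_pcomp.
move=> x /pd[y fxy]; have [dg _ _ _] := graph_bij gam.
have [z gyz] : pdom gam y by rewrite dg; exact: pX fxy.
by exists z, y.
Qed.

Lemma Vgroup_inv (gam : sym X) : Vgroup n primed gam -> Vgroup n primed (gam^-1)%g.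
Proof. by move=> /VgroupP ?; apply/VgroupP; exact: Shat_pinv. Qed.

Lemma Vgroup_mul (gam del : sym X) : Vgroup n primed gam -> Vgroup n primed del ->
  Vgroup n primed (gam * del)%g.
Proof. by move=> /VgroupP ? /VgroupP ?; apply/VgroupP; exact: Shat_pcomp. Qed.

(** Translating by the inverse of [gam] brings [r] into the class of [p], hence of [q]; translating
    back gives the claim. Thus the action is well defined on classes. *)
Lemma cls_pcomp_sub (gam : sym X) p q :
  Vgroup n primed gam -> marked n primed p -> marked n primed q ->
  cls n primed p `<=` cls n primed q ->
  cls n primed (pcomp gam p.1, p.2) `<=` cls n primed (pcomp gam q.1, q.2).
Proof.
move=> Vg mp mq pq r [mr [h hS /= e]]; split=> //.
have VgV := Vgroup_inv Vg.
have [_ [h' hS' /= e']] : cls n primed q (pcomp (gam^-1)%g r.1, r.2).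
  apply: pq; split; first exact: marked_pcomp.
  exists h => //=.
  have -> : prestrict p.1 p.2 = pcomp (gam^-1)%g (prestrict (pcomp gam p.1) p.2).
    by rewrite -prestrict_pcomp pcomp_symK //; exact: marked_X.
  by rewrite e pcompA.
exists h' => //=; rewrite prestrict_pcomp e' pcompA.
by have := @pcomp_symK (gam^-1)%g r.1 (marked_X mr); rewrite invgK => ->.
Qed.

Lemma cls_pcomp (gam : sym X) p q :
  Vgroup n primed gam -> marked n primed p -> marked n primed q ->
  cls n primed p = cls n primed q ->
  cls n primed (pcomp gam p.1, p.2) = cls n primed (pcomp gam q.1, q.2).
Proof. by move=> Vg mp mq e; apply/seteqP; split; apply: cls_pcomp_sub; rewrite ?e. Qed.

Lemma stabilizer_subgroup (v : set (set (parmap R * set R))) : is_vertex n primed v ->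
  subgroup (stabilizer n primed v).
Proof.
move=> [k [F [D [mF vE _ _]]]].
have v_marked c : v c ->
    exists2 p : parmap R * set R, marked n primed p & c = cls n primed p.
  by rewrite vE => -[j _ <-]; exists (F j, D j).
have K1 : stabilizer n primed v 1%g.
  split; first exact/VgroupP/Shat_id.
  have one p : marked n primed p -> (pcomp (1%g : sym X) p.1, p.2) = p.
    move=> mp; case: p mp => f E mp /=; congr pair.
    apply/seteqP; split=> -[x y]; first by move=> [z fxz /parmap_ofE/= [_ ->]].
    move=> fxy; exists y => //; apply/parmap_ofE; split=> //=.
    exact: (marked_X mp) fxy.
  apply/seteqP; split=> [_ [p [mp vp] <-]|c vc]; first by rewrite one.
  by have [p mp cp] := v_marked c vc; exists p; rewrite ?one//= -cp.
split; first by rewrite in_setE.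
move=> gam del; rewrite !in_setE => -[Vg ag] [Vd ad].
have VdV := Vgroup_inv Vd.
split; first exact: Vgroup_mul.
(* Each class of [v] is the translate by [del] of a class of [v], so the inverse of [del] maps [v]
   into itself. *)
have adV p : marked n primed p -> v (cls n primed p) ->
    v (cls n primed (pcomp (del^-1)%g p.1, p.2)).
  move=> mp; rewrite -{1}ad => -[q [mq vq] e].
  rewrite -(cls_pcomp VdV (marked_pcomp Vd mq) mp e) /=.
  by rewrite pcomp_symK ?(marked_X mq)//; last exact: marked_X; case: q mq vq e.
apply/seteqP; split=> [_ [p [mp vp] <-]|c].
  have mp' := marked_pcomp VdV mp.
  rewrite -ag; exists (pcomp (del^-1)%g p.1, p.2); last by rewrite /= pcompA.
  by split=> //; exact: adV.
rewrite -{1}ag => -[p [mp vp] <-].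
exists (pcomp del p.1, p.2).
  split; first exact: marked_pcomp.
  by rewrite -ad; exists p.
congr (cls n primed (_, _)).
rewrite -[LHS]/(pcomp (pcomp gam (del^-1)%g) (pcomp del p.1)) -pcompA.
by rewrite pcomp_symK//; exact: marked_X.
Qed.

End Piecewise.

(** * From a vertex to its charts *)

Lemma sim_pimage (R : realType) (n : nat) (primed : bool) (p q : parmap R * set R) :
  sim n primed p q -> pimage p.1 p.2 = pimage q.1 q.2.
Proof.
move=> [h [_ dh Ih] e]; apply/seteqP; split=> z.
  move=> [x Dx pxz]; have : prestrict p.1 p.2 (x, z) by [].
  by rewrite e => -[y /= hxy qyz]; exists y => //; rewrite -Ih; exists x.
rewrite -{1}Ih => -[y [x Dx hxy] qyz]; exists x => //.
by have [] : prestrict p.1 p.2 (x, z) by rewrite e; exists y.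
Qed.

(** The [j]-th chart [e j] is [F j] after a Moebius parametrization [w j] of [D j] by the half-line;
    disjointness and covering of the images give the chart hypotheses. *)
Lemma vertex_charts (R : realType) (n : nat) (primed : bool) (k : nat)
    (F : 'I_k -> parmap R) (D : 'I_k -> set R)
    (v : set (set (parmap R * set R))) :
  prime n -> (forall j, marked n primed (F j, D j)) ->
  v = [set cls n primed (F j, D j) | j in [set: 'I_k]] ->
  trivIset [set: 'I_k] (fun j => pimage (F j) (D j)) ->
  \bigcup_j pimage (F j) (D j) = Xspace primed ->
  virtually_free_abelian_of_rank_le k (stabilizer n primed v).
Proof.
move=> n_prime mF vE Ftriv Fcov; have n_gt0 := prime_gt0 n_prime.
have FX j x y : F j (x, y) -> Xspace primed y := @marked_X _ _ _ _ (mF j) x y.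
have FP j : (forall x y y', F j (x, y) -> F j (x, y') -> y = y') /\
    (forall x x' y, F j (x, y) -> F j (x', y) -> x = x').
  by have [/ShatP[_ ? ? _]] := mF j.
have /choice[w wP] : forall j, exists wj : parmap R,
    [/\ mobius n wj, pdom wj = halfline 0 & pimage wj (halfline 0) = D j].
  by move=> j; have [_ gD _] := mF j; exact: Dgen_chart gD.
(* For [x >= 0] both applications are inside the domains, so the junk value 0 of [papply] is never
   read there. *)
pose e j x := papply (F j) (papply (w j) x).
have eP j x : 0 <= x -> exists2 y, w j (x, y) & F j (y, e j x) /\ D j y.
  move=> x0; have [mw dw Iw] := wP j.
  have [y wxy] : pdom (w j) x by rewrite dw; exact/halflineE.
  have Dy : D j y by rewrite -Iw; exists x => //; exact/halflineE.
  have [_ _ DF] := mF j; have [z Fyz] := DF y Dy.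
  exists y => //; suff -> : e j x = z by [].
  rewrite /e (@papplyE _ (w j) x y) //; last first.
    by move=> t wt; exact: mobius_fun mw wt wxy.
  by apply: papplyE => // t Ft; exact: (FP j).1 Ft Fyz.
have e_val j x y z : 0 <= x -> w j (x, y) -> F j (y, z) -> z = e j x.
  move=> x0 wxy Fyz; have [y' wxy' [Fy' _]] := eP j x x0; have [mw _ _] := wP j.
  by rewrite (mobius_fun mw wxy' wxy) in Fy'; exact: (FP j).1 Fyz Fy'.
apply: (@scaling_charts_virtually_free_abelian R _ _ k e n%:R).
- by rewrite ltr1n prime_gt1.
- by apply: stabilizer_subgroup => //; exists k, F, D; split.
- by move=> j x /(eP j)[y _ [/FX]].
- move=> z; rewrite -{1}Fcov => -[j _ [y]]; have [_ _ {1}<-] := wP j.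
  by move=> [x /halflineE x0 wxy] Fyz; exists j, x => //; exact: e_val Fyz.
- move=> i j x y x0 y0 exy.
  have [x' wx' [Fx' Dx']] := eP i x x0; have [y' wy' [Fy' Dy']] := eP j y y0.
  have ij : i = j.
    by apply: Ftriv => //; exists (e i x); split; [exists x' | rewrite exy; exists y'].
  split=> //; rewrite -ij in exy wy' Fy'; have [mw _ _] := wP i.
  rewrite -exy in Fy'; rewrite ((FP i).2 _ _ _ Fy' Fx') in wy'.
  exact: mobius_inj mw wx' wy'.
move=> gam [Vg gv].
have [dg _ _ _] := graph_bij gam.
suff chart i : exists jz : 'I_k * int, forall x, 0 <= x ->
    graph gam (e i x, e jz.1 (n%:R ^ jz.2 * x)).
  have [jz jzP] := choice chart.
  exists (fun i => (jz i).1), (\row_i (jz i).2) => i x x0; rewrite mxE.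
  exact: jzP.
have : v (cls n primed (pcomp gam (F i), D i)).
  rewrite -gv; exists (F i, D i) => //; split; first exact: mF.
  by rewrite vE; exists i.
rewrite vE => -[j _ ij].
(* Reflexivity turns the equality of classes into an [h] from [D i] onto [D j] with [gam] after
   [F i] equal to [F j] after [h] on [D i]. *)
have [_ [h [/= Sh dh Ih] /= eh]] : cls n primed (pcomp gam (F i), D i) (F j, D j).
  by rewrite -ij; exact: cls_refl.
have [mi di Ii] := wP i; have [mj dj Ij] := wP j.
have mh := semigrp_mobius n_gt0 Sh.
(* Read in the charts, [gam] becomes this conjugate of [h], a Moebius self-bijection of the
   half-line. *)
have [| | |z zP] := @mobius_halfline R n n_gt0 n_prime
    (pcomp (pinv (w j)) (pcomp h (w i))).
- by apply: mobius_pcomp; [exact: mobius_pcomp | exact: mobius_pinv].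
- apply/seteqP; split=> [x [t [s /= [y /= wxy _] _]]|x].
    by rewrite -di; exists y.
  rewrite -{1}di => -[y wxy].
  have [s hys] : pdom h y by rewrite dh -Ii; exists x => //; rewrite -di; exists y.
  have : D j s by rewrite -Ih; exists y => //; rewrite -dh; exists s.
  by rewrite -Ij => -[t _ wts]; exists t, s => //; exists y.
- apply/seteqP; split=> [t [x x0 [s _ /= wts]]|t].
    by rewrite -dj; exists s.
  rewrite -{1}dj => -[s wts].
  have : D j s by rewrite -Ij; exists t => //; rewrite -dj; exists s.
  rewrite -{1}Ih => -[y]; rewrite -{1}Ii => -[x x0 wxy] hys.
  by exists x => //; exists s => //; exists y.
exists (j, z) => x x0 /=.
have [s [y /= wxy hys] wts] := zP x x0; rewrite /pinv /= in wts.
have [y' wxy' [Fy Dy]] := eP i x x0.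
rewrite (mobius_fun mi wxy' wxy) in Fy Dy.
have [t gt] : pdom gam (e i x) by rewrite dg; exact: FX Fy.
have : prestrict (pcomp gam (F i)) (D i) (y, t) by split=> //; exists (e i x).
rewrite eh => -[s' /= hys' Fst]; rewrite (mobius_fun mh hys' hys) in Fst.
have z0 : 0 <= n%:R ^ z * x by rewrite mulr_ge0// exprz_ge0.
by rewrite -(e_val j _ _ _ z0 wts Fst).
Qed.

(* Otherwise the numerals 2 and 3 below would be read in [ring_scope]. *)
Local Close Scope ring_scope.

Theorem proposition4p13 (R : realType) (n : nat) (hn : n = 2 \/ n = 3)
    (primed : bool) (m : nat) (v : set (set (parmap R * set R)))
    (hv : is_vertex n primed v) (hm : v #= `I_m) :
  virtually_free_abelian_of_rank_le m (stabilizer n primed v).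
Proof.
have n_prime : prime n by case: hn => ->.
have n_gt0 := prime_gt0 n_prime.
have [k [F [D [mF vE Ftriv Fcov]]]] := hv.
(* Equal classes have equal images, which are non-empty since [D i] contains the chart image of 0;
   disjointness then forces equal indices. Hence the indexing family has exactly [m] members. *)
have cls_inj : {in [set: 'I_k] &, injective (fun j => cls n primed (F j, D j))}.
  move=> i j _ _ eij.
  have [_ /sim_pimage/= ij] : cls n primed (F i, D i) (F j, D j).
    by rewrite eij; exact: cls_refl.
  have [/= _ gD DF] := mF i; have [w [_ dw Iw]] := Dgen_chart n_gt0 gD.
  have [y wy] : pdom w 0%R by rewrite dw; exact/halflineE.
  have Dy : D i y by rewrite -Iw; exists 0%R => //; exact/halflineE.
  have [z Fz] := DF y Dy.
  by apply: Ftriv => //; exists z; rewrite -ij setIid; exists y.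
have <- : k = m; last exact: vertex_charts Fcov.
apply/card_eq_II; apply: card_eq_trans hm; rewrite vE.
rewrite card_eq_sym; apply: card_eq_trans (inj_card_eq cls_inj) _.
by rewrite card_eq_sym card_II.
Qed.
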